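(* Let $m\ge 3$, $n\ge 2$ and $2\le l\le\lceil n/2\rceil$. For every positive integer $k$, $$\chi_{B_l(m,n)}(2k+1)=\Big[\sum_{i=0}^{m-2}(-1)^i(2k)^{(m-2)-i}\Big]\,\chi_{B_l(m,n-1)}(2k+1).$$
   Context: A signed graph $(G,\sigma)$ is a finite graph $G$ with a sign function $\sigma:E(G)\to\{+1,-1\}$; its signature is the set of negative edges. A signed coloring in $2k+1$ colors is a map $c:V(G)\to\{-k,\dots,k\}$; it is proper if $c(y)\neq\sigma(e)c(x)$ for every edge $e=xy$. The signed chromatic polynomial $\chi_{(G,\sigma)}(2k+1)$ is the number of proper signed colorings in $2k+1$ colors. For integers $m\ge 3$, $n\ge 1$, the Book graph $B(m,n)$ has vertex set $\{u,v\}\cup\{u_j^l:1\le l\le n,\,1\le j\le m-2\}$ and consists of the $n$ cycles $u\,u_1^l\cdots u_{m-2}^l\,v\,u$ sharing the edge $uv$. For $1\le l\le n$, $B_l(m,n)$ denotes $B(m,n)$ with signature $\{uu_1^1,uu_1^2,\dots,uu_1^l\}$. *)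

(* Defs.v *)
From HB Require Import structures.
From mathcomp Require Import all_boot all_order all_algebra.

Set Implicit Arguments.
Unset Strict Implicit.
Unset Printing Implicit Defensive.

Import Order.TTheory GRing.Theory Num.Theory.
Local Open Scope ring_scope.

Record graph := Graph {
  vertex : finType;
  edges : {set {set vertex}};
  edges_card2 : forall e, e \in edges -> #|e| = 2%N
}.

(* The values of [sign] outside of the edge set are irrelevant. *)
Record signed_graph := SignedGraph {
  underlying :> graph;
  sign : {set vertex underlying} -> int;
  sign_pm1 : forall e, e \in edges underlying -> sign e = 1 \/ sign e = -1
}.

Definition signature (G : signed_graph) : {set {set vertex G}} :=
  [set e in edges G | sign e == -1].

Section WithSignature.
Variables (G : graph) (S : {set {set vertex G}}).

Definition sign_of_signature (e : {set vertex G}) : int :=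
  if e \in S then -1 else 1.

Lemma sign_of_signature_pm1 e :
  e \in edges G -> sign_of_signature e = 1 \/ sign_of_signature e = -1.
Proof. by move=> _; rewrite /sign_of_signature; case: ifP; [right | left]. Qed.

Definition with_signature : signed_graph := SignedGraph sign_of_signature_pm1.

Lemma signature_with_signature :
  S \subset edges G -> signature with_signature = S.
Proof.
move=> /subsetP SE; apply/setP=> e; rewrite inE /= /sign_of_signature.
by case: ifP => [/SE -> | _]; rewrite ?eqxx ?andbF.
Qed.
End WithSignature.

(* The integers -k, ..., k. *)
Definition colors (k : nat) : seq int := [seq i%:Z - k%:Z | i <- iota 0 (2 * k).+1%N].

Lemma mem_colors (k : nat) (x : int) : (x \in colors k) = (- k%:Z <= x <= k%:Z).
Proof.
apply/mapP/andP => [[i]|[le_kx le_xk]].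
  rewrite mem_iota add0n ltnS /= => le_i ->.
  by rewrite lerBrDr addNr lerBlDr -PoszD addnn -mul2n !lez_nat.
have x_ge0 : 0 <= x + k%:Z by rewrite -lerBlDr sub0r.
exists (absz (x + k%:Z)); last by rewrite gez0_abs // addrK.
by rewrite mem_iota add0n ltnS /= -lez_nat gez0_abs // mul2n -addnn PoszD lerD2r.
Qed.

Definition proper_coloring (G : signed_graph) (k : nat)
    (c : {ffun vertex G -> seq_sub (colors k)}) : bool :=
  [forall x, forall y, ([set x; y] \in edges G) ==>
    (ssval (c y) != sign [set x; y] * ssval (c x))].

(* The value at 2k+1 of the signed chromatic polynomial. *)
Definition signed_chrom (G : signed_graph) (k : nat) : nat :=
  #|[set c : {ffun vertex G -> seq_sub (colors k)} | proper_coloring c]|.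

(* [s] lists the vertices of a cycle in cyclic order. *)
Definition cycle_edges (T : finType) (s : seq T) : {set {set T}} :=
  [set [set x; next s x] | x in s].

Lemma cycle_edges_card2 (T : finType) (s : seq T) e :
  uniq s -> (1 < size s)%N -> e \in cycle_edges s -> #|e| = 2%N.
Proof.
move=> Us s_gt1 /imsetP[x sx ->]; rewrite cards2.
suff -> : x != next s x by [].
have [i p def_s] := rot_to sx.
rewrite -(next_rot i Us) def_s.
have : uniq (x :: p) by rewrite -def_s rot_uniq.
have : (1 < size (x :: p))%N by rewrite -def_s size_rot.
by case: p {def_s} => //= y p _; rewrite eqxx inE negb_or -andbA => /andP[].
Qed.

Section Book.
Variables m n : nat.

Definition book_vertex : finType := (bool + 'I_n * 'I_(m - 2))%type.
Definition book_u : book_vertex := inl false.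
Definition book_v : book_vertex := inl true.
(* Indices start at 0: [book_w i j] is the vertex u_{j+1}^{i+1}. *)
Definition book_w (i : 'I_n) (j : 'I_(m - 2)) : book_vertex := inr (i, j).

Definition book_page (i : 'I_n) : seq book_vertex :=
  book_u :: rcons [seq book_w i j | j <- enum 'I_(m - 2)] book_v.

Definition book_edges : {set {set book_vertex}} :=
  \bigcup_(i < n) cycle_edges (book_page i).

Lemma book_page_uniq i : uniq (book_page i).
Proof.
rewrite /= mem_rcons inE rcons_uniq map_inj_uniq ?enum_uniq; last by move=> j k [].
by rewrite andbT /= ; apply/andP; split; apply/mapP => -[].
Qed.

Lemma book_edges_card2 e : e \in book_edges -> #|e| = 2%N.
Proof.
case/bigcupP => i _; apply: cycle_edges_card2; first exact: book_page_uniq.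
by rewrite /= size_rcons.
Qed.

Definition book : graph := Graph book_edges_card2.

(* The edges u u_1^1, ..., u u_1^l. *)
Definition book_signature (l : nat) : {set {set vertex book}} :=
  [set [set book_u; book_w i j] | i in [pred i : 'I_n | (i < l)%N],
                                  j in [pred j : 'I_(m - 2) | val j == 0%N]].

Lemma book_signature_sub l : book_signature l \subset edges book.
Proof.
apply/subsetP => e /imset2P[i j _]; rewrite inE => /eqP j0 ->.
apply/bigcupP; exists i => //; apply/imsetP; exists book_u.
  by rewrite inE eqxx.
have lt0 : (0 < m - 2)%N by case: (m - 2)%N j {j0} => [[]|].
suff -> : next (book_page i) book_u = book_w i j by [].
rewrite /book_page.
case def_s: (enum 'I_(m - 2)) => [|j' s] /=.
  by move: lt0; rewrite -{1}(size_enum_ord (m - 2)) def_s.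
congr (inr (i, _)); apply: val_inj; rewrite /= [RHS]j0.
by have /= := nth_enum_ord j lt0; rewrite def_s.
Qed.

Definition signed_book (l : nat) : signed_graph :=
  with_signature (book_signature l).
End Book.

(* Main.v *)
(** Given colors [a] of [u] and [b] of [v], the pages are colored independently,
    so the number of proper colorings is a sum over [a != b] of a product of
    page counts.  As [l <= uphalf n < n], the last page is all-positive, and its
    colorings are the walks of length [m - 1] from [a] to [b] in the complete
    graph on [2k + 1] vertices.  For [a != b] their number is the alternating sum
    of the theorem, whatever [a] and [b], and it factors out. *)
Require Import Defs.
From mathcomp Require Import all_boot all_order all_algebra.
From mathcomp Require Import ring zify.

Import Order.TTheory GRing.Theory Num.Theory.
Local Open Scope ring_scope.

Definition alt_sum (Q : int) (p : nat) : int :=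
  \sum_(0 <= i < p.+1) (-1) ^+ i * Q ^+ (p - i)%N.

Lemma alt_sumS Q p : alt_sum Q p.+1 = Q * alt_sum Q p + (-1) ^+ p.+1.
Proof.
rewrite /alt_sum big_nat_recr //= subnn expr0 mulr1; congr (_ + _).
rewrite big_distrr /=; apply: eq_big_nat => i /andP[_ lt_i].
by rewrite subSn // exprS mulrCA.
Qed.

Lemma big_tuple_cons (R : Type) (idx : R) (op : Monoid.com_law idx)
    (T : finType) (p : nat) (F : p.+1.-tuple T -> R) :
  \big[op/idx]_t F t =
  \big[op/idx]_(x : T) \big[op/idx]_(t : p.-tuple T) F [tuple of x :: t].
Proof.
rewrite pair_bigA /=.
rewrite (reindex (fun xt : T * p.-tuple T => [tuple of xt.1 :: xt.2])) //.
exists (fun t : p.+1.-tuple T => (thead t, [tuple of behead t])).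
  by case=> x t _; congr pair; apply: val_inj.
by move=> t _; rewrite [RHS]tuple_eta.
Qed.

(** Here [t] lists the inner vertices of a walk of length [p.+1]. The induction removes the first
    step, which may land on [b]; hence the case [a = b] and its correction term are carried
    along. *)
Lemma sum_walks_complete (C : finType) (Q p : nat) (a b : C) : #|C| = Q.+1 ->
  \sum_(t : p.-tuple C) (path (fun x y => y != x) a (rcons t b))%:R
  = alt_sum Q%:Z p - (-1) ^+ p * (a == b)%:R.
Proof.
move=> cardC; elim: p a => [|p IHp] a.
  rewrite (bigD1 [tuple]) //= big1 ?addr0; last by move=> t /eqP[]; exact: tuple0.
  by rewrite /alt_sum big_nat1 andbT eq_sym; case: eqP.
(* A first step that stays at [a] contributes nothing. *)
rewrite big_tuple_cons (bigD1 a) //= big1 ?add0r; last by move=> t _; rewrite eqxx.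
rewrite (eq_bigr (fun c => alt_sum Q%:Z p - (-1) ^+ p * (c == b)%:R)); last first.
  by move=> c ca; rewrite -IHp; apply: eq_bigr => t _; rewrite ca.
rewrite sumrB sumr_const cardC1 cardC /= -mulr_sumr alt_sumS exprS.
suff -> : \sum_(i | i != a) (i == b)%:R = 1 - (a == b)%:R :> int.
  by rewrite -mulr_natl natz; ring.
have [<-|neq] := eqVneq a b.
  by rewrite big1 ?subrr // => i /negPf ->.
rewrite (bigD1 b) /= 1?eq_sym // eqxx big1 ?addr0 ?subr0 //.
by move=> i /andP[_ /negPf ->].
Qed.

Lemma colors_uniq k : uniq (colors k).
Proof.
rewrite map_inj_uniq ?iota_uniq // => i j /(congr1 (fun x => x + k%:Z)).
by rewrite !subrK => -[].
Qed.

Lemma card_colors k : #|{: seq_sub (colors k)}| = (2 * k).+1.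
Proof. by rewrite card_seq_sub ?colors_uniq // size_map size_iota. Qed.

(** Turns a condition on unordered edges into one on consecutive entries of [s]; symmetry of [e]
    compensates for the lost orientation. *)
Lemma cycle_edgesP (T : finType) (e : rel T) (s : seq T) : uniq s -> symmetric e ->
  (forall x y, [set x; y] \in cycle_edges s -> e x y) <-> cycle e s.
Proof.
move=> Us symE; split=> [He|Hc x y].
  by apply: cycle_from_next => // x sx; apply: He; apply: imset_f.
case/imsetP=> z sz Exy; have ez := next_cycle Hc sz.
have := set21 x y; have := set22 x y; rewrite Exy !inE.
have := set21 z (next s z); have := set22 z (next s z); rewrite -Exy !inE.
do 4![case/orP=> /eqP ?]; subst=> //; by [rewrite symE | congruence].
Qed.

(** Only the first edge of a page can be negative, so its sign is moved onto the color of [u]. The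
    path lives in [int], which avoids negation on the color type. *)
Definition page_ok k (neg : bool) (a b : seq_sub (colors k))
    (s : seq (seq_sub (colors k))) : bool :=
  path (fun x y : int => y != x) ((-1) ^+ neg * ssval a) (map (@ssval _ _) (rcons s b)).

Lemma page_ok_pos k (a b : seq_sub (colors k)) s :
  page_ok k false a b s = path (fun x y => y != x) a (rcons s b).
Proof. by rewrite /page_ok mul1r path_map. Qed.

Section SignedBook.
Variables (m n l k : nat).
Hypothesis m_gt2 : (0 < m - 2)%N.
Let G := signed_book m n l.
Let C := seq_sub (colors k).
Implicit Type c : {ffun vertex G -> C}.

Definition edge_ok c : rel (vertex G) :=
  fun x y => ssval (c y) != sign (s := G) [set x; y] * ssval (c x).

(** A sign is its own inverse. *)
Lemma edge_ok_sym c : symmetric (edge_ok c).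
Proof.
move=> x y; rewrite /edge_ok [[set y; x]]setUC /= /sign_of_signature.
by case: ifP => _; rewrite ?mul1r ?mulN1r 1?eq_sym // eqr_oppLR.
Qed.

Lemma sign_uw (i : 'I_n) (j : 'I_(m - 2)) : val j = 0%N ->
  sign (s := G) [set book_u m n; book_w i j] = (-1) ^+ (i < l)%N.
Proof.
move=> j0; rewrite /= /sign_of_signature; suff -> :
  ([set book_u m n; book_w i j] \in book_signature m n l) = (i < l)%N by case: ltnP.
apply/imset2P/idP => [[i' j' li' _ /setP/(_ (book_w i j))]|li].
  rewrite !inE eqxx orbT /= => /esym/eqP[-> _]; exact: li'.
by exists i j => //; rewrite inE j0.
Qed.

(** A negative edge contains [u] and avoids [v]. This covers the edge [uv] and every page edge after
    the first. *)
Lemma sign_not_uw (x y : vertex G) :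
  (x != book_u m n) && (y != book_u m n) || (x == book_v m n) || (y == book_v m n) ->
  sign (s := G) [set x; y] = 1.
Proof.
move=> H; rewrite /= /sign_of_signature; case: ifP => // /imset2P[i j _ _ E].
have := set21 (book_u m n) (book_w i j); rewrite -E !inE.
have := set21 x y; have := set22 x y; rewrite E !inE.
case/orP: H => [/orP[/andP[/negPf xu /negPf yu]|/eqP->]|/eqP->] //.
by rewrite ![book_u m n == _]eq_sym xu yu.
Qed.

Lemma page_cycle c (i : 'I_n) : cycle (edge_ok c) (book_page m i) =
  (c (book_v m n) != c (book_u m n)) &&
  page_ok k (i < l)%N (c (book_u m n)) (c (book_v m n))
    [tuple c (book_w i j) | j < m - 2].
Proof.
rewrite /book_page /= rcons_path last_rcons andbC; congr andb.
  by rewrite edge_ok_sym /edge_ok sign_not_uw ?mul1r ?eqxx ?orbT //.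
rewrite /page_ok /= map_rcons /=.
(* As [m - 2] is positive, the walk from [u] first meets an inner vertex, the one of index 0. *)
case E: (enum 'I_(m - 2)) => [|j0 s].
  by move: m_gt2; rewrite -{1}(size_enum_ord (m - 2)) E.
have j00 : val j0 = 0%N by have /= := nth_enum_ord j0 m_gt2; rewrite E.
rewrite /= {1}/edge_ok sign_uw //; congr andb.
rewrite -!map_comp -[ssval (c (book_v m n))]/((fun x => ssval (c x)) (book_v m n)).
(* Beyond [j0] the walk never meets [u], so all remaining signs are 1. *)
elim: s j0 {E j00} => [|j s IHs] j0 /=; rewrite {1}/edge_ok sign_not_uw ?mul1r //.
by rewrite IHs.
Qed.

Lemma proper_coloringE c : (0 < n)%N -> proper_coloring c =
  (c (book_v m n) != c (book_u m n)) &&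
  [forall i : 'I_n, page_ok k (i < l)%N (c (book_u m n)) (c (book_v m n))
     [tuple c (book_w i j) | j < m - 2]].
Proof.
move=> n_gt0; apply/idP/andP.
  move=> /'forall_forallP Hc.
  have Hcyc i : cycle (edge_ok c) (book_page m i).
    apply/cycle_edgesP; [exact: book_page_uniq | exact: edge_ok_sym|].
    move=> x y xy; apply: (implyP (Hc x y)); apply/bigcupP; by exists i.
  (* The edge [uv] occurs only as the closing edge of a page, so some page must exist. *)
  split; first by have := Hcyc (Ordinal n_gt0); rewrite page_cycle => /andP[].
  by apply/forallP=> i; have := Hcyc i; rewrite page_cycle => /andP[].
case=> Huv /forallP Hp; apply/'forall_forallP=> x y; apply/implyP => /bigcupP[i _].
move: x y; apply/cycle_edgesP; [exact: book_page_uniq | exact: edge_ok_sym|].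
by rewrite page_cycle Huv Hp.
Qed.

(** Grouping the inner colors by page lets a sum over [F] distribute into a product over pages. *)
Definition book_coloring (abF : C * C * {ffun 'I_n -> (m - 2).-tuple C}) :
    {ffun vertex G -> C} :=
  [ffun x : book_vertex m n => match x with
    | inl b => if b then abF.1.2 else abF.1.1
    | inr (i, j) => tnth (abF.2 i) j
    end].

Lemma book_coloring_bij : bijective book_coloring.
Proof.
exists (fun c => (c (book_u m n), c (book_v m n),
  [ffun i => [tuple c (book_w i j) | j < m - 2]])).
  case=> [[a b] F]; rewrite !ffunE; congr (_, _, _).
  by apply/ffunP=> i; rewrite ffunE; apply: eq_from_tnth => j; rewrite tnth_mktuple ffunE.
move=> c; apply/ffunP => -[[]|[i j]]; rewrite ffunE //=.
by rewrite ffunE tnth_mktuple.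
Qed.

Lemma signed_chrom_book : (0 < n)%N ->
  (signed_chrom G k)%:Z = \sum_(ab : C * C | ab.2 != ab.1)
    \prod_(i < n) \sum_(t : (m - 2).-tuple C) (page_ok k (i < l)%N ab.1 ab.2 t)%:R.
Proof.
move=> n_gt0; rewrite /signed_chrom -sum1_card -natz natr_sum.
rewrite (reindex book_coloring) /=; last exact: onW_bij book_coloring_bij.
rewrite big_mkcond /=.
rewrite (eq_bigr (fun abF : C * C * {ffun 'I_n -> (m - 2).-tuple C} =>
  (abF.1.2 != abF.1.1)%:R *
  \prod_(i < n) (page_ok k (i < l)%N abF.1.1 abF.1.2 (abF.2 i))%:R)); last first.
  case=> [[a b] F] _; rewrite inE proper_coloringE // !ffunE /=.
  case: (b != a) => /=; rewrite ?mul0r // mul1r.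
  have /= E i : val [tuple book_coloring (a, b, F) (book_w i j) | j < m - 2] = F i.
    by congr val; apply: eq_from_tnth => j; rewrite tnth_mktuple ffunE.
  (* The indicator of a conjunction is the product of the indicators. *)
  case: forallP => [H|/forallP].
    by rewrite big1 // => i _; have := H i; rewrite E => ->.
  rewrite negb_forall => /existsP[i]; rewrite E => /negPf Hi.
  by rewrite (bigD1 i) //= Hi mul0r.
rewrite -(pair_bigA _ (fun (ab : C * C) (F : {ffun 'I_n -> (m - 2).-tuple C}) =>
  (ab.2 != ab.1)%:R *
  \prod_(i < n) (page_ok k (i < l)%N ab.1 ab.2 (F i))%:R)) /=.
rewrite [RHS]big_mkcond /=; apply: eq_bigr => ab _.
rewrite -mulr_sumr bigA_distr_bigA /=.
by case: ifP => _; rewrite ?mul1r ?mul0r.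
Qed.
End SignedBook.

Theorem theorem6p9 (m n l k : nat) (hm : (3 <= m)%N) (hn : (2 <= n)%N)
    (hl2 : (2 <= l)%N) (hln : (l <= uphalf n)%N) (hk : (0 < k)%N) :
  (signed_chrom (signed_book m n l) k)%:Z =
  (\sum_(0 <= i < (m - 2).+1%N) (-1) ^+ i * (2 * k)%N%:Z ^+ ((m - 2) - i)%N)
    * (signed_chrom (signed_book m (n - 1)%N l) k)%:Z.
Proof.
have m_gt2 : (0 < m - 2)%N by lia.
case: n hn hln => // n hn hln; rewrite subn1 /=.
(* The smaller book still has a page, since [n.+1] is at least 2. *)
rewrite !signed_chrom_book //; try lia.
rewrite -/(alt_sum (2 * k)%N%:Z (m - 2)) mulr_sumr; apply: eq_bigr => -[a b] /= ba.
rewrite big_ord_recr /= mulrC; congr (_ * _).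
(* For positive [n], [uphalf n.+1] is at most [n], so the page of index [n] carries no negative
   edge. *)
have -> : (n < l)%N = false by lia.
under eq_bigr do rewrite page_ok_pos.
by rewrite (sum_walks_complete _ _ _ _ _ (card_colors k)) eq_sym (negPf ba) mulr0 subr0.
Qed.
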